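(* Let $T$ be a complete $L$-theory. For all $L$-formulas $\phi(x,y)$ and $\psi(x,y)$ and all $r\in\mathbb R$: 1. $\operatorname{stb}_T(\phi(x,y))=0$ if $\phi$ is constant in $T$; 2. $\operatorname{stb}_T(r\phi(x,y))=|r|\operatorname{stb}_T(\phi(x,y))$; 3. $\operatorname{stb}_T((\phi+\psi)(x,y))\leq\operatorname{stb}_T(\phi(x,y))+\operatorname{stb}_T(\psi(x,y))$; 4. $\operatorname{stb}_T(\phi(x,y))\leq\operatorname{diam}_T(\phi)$.
   Context: Logic: We work in continuous (metric) first-order logic with values in $\mathfrak V=\ell^\infty(\omega)$ (real Banach space), with metric $\mathfrak d(\mathfrak r,\mathfrak s)=\|\mathfrak r-\mathfrak s\|_\infty$; an isometric copy $\mathbb R\hookrightarrow\mathfrak V$ is fixed. It is set up as standard $[0,1]$-valued continuous logic (complete metric structures, possibly many-sorted, symbols with prescribed moduli of uniform continuity), except that each predicate symbol $P$ of the language $L$ comes with a compact set $K_P\subseteq\mathfrak V$ in which it takes values; connectives are all continuous functions $u:\mathfrak V^n\to\mathfrak V$ (in particular vector addition and scalar multiplication of $\mathfrak V$, used to form $\phi+\psi$ and $r\phi$); and $\sup_x\psi$, $\inf_x\psi$ are formed only for formulas $\psi$ with value set $K_\psi\subseteq\mathbb R^{\geq0}$. Inductively each formula $\phi$ has a compact value set $K_\phi\subseteq\mathfrak V$ ($K_{u(\phi_0,\ldots,\phi_{n-1})}=u(\prod_i K_{\phi_i})$, and $K_{\sup_x\psi}=K_{\inf_x\psi}=K_\psi$),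 and $\phi^M$ takes values in $K_\phi$ in every $L$-structure $M$. Here $x,y$ are tuples of variables and $M^x$ is the product of sorts of $M$ corresponding to $x$. $\operatorname{diam}_T(\phi)=\sup\{\mathfrak d(\phi^M(a,b),\phi^M(a',b')):a,a'\in M^x,\ b,b'\in M^y,\ M\models T\}$. ''$\phi$ is constant in $T$'' means that $\phi^M$ is a constant function for every $M\models T$. Stability: for $\epsilon>0$, $\phi(x,y)$ is $\epsilon$-stable in $T$ if there do not exist a model $M\models T$, $\mathfrak r,\mathfrak s\in K_\phi$, and sequences $\langle a_i\rangle_{i<\omega}$ in $M^x$ and $\langle b_i\rangle_{i<\omega}$ in $M^y$ such that, for all $i<j<\omega$, $\phi^M(a_i,b_j)=\mathfrak r$, $\phi^M(a_j,b_i)=\mathfrak s$, and $\mathfrak d(\mathfrak r,\mathfrak s)\geq\epsilon$. Finally $$\operatorname{stb}_T(\phi(x,y))=\inf\{\epsilon>0:\phi(x,y)\text{ is }\epsilon\text{-stable in }T\}\in\mathbb R^{\geq0}.$$ *)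

(* Defs.v *)
From HB Require Import structures.
From mathcomp Require Import all_boot all_order all_algebra.
From mathcomp Require Import all_classical all_reals all_analysis.

Set Implicit Arguments.
Unset Strict Implicit.
Unset Printing Implicit Defensive.

Import Order.TTheory GRing.Theory Num.Theory.
Import numFieldNormedType.Exports.

Local Open Scope classical_set_scope.
Local Open Scope ring_scope.

Section Linfty.
Context {R : realType}.

Definition bounded_seq : {pred (nat -> R)} :=
  mem [set f : nat -> R | bounded_fun f].

Lemma bounded_seqP (f : nat -> R) :
  f \in bounded_seq <-> exists M : R, forall n, `|f n| <= M.
Proof.
split=> [/set_mem[M [_ fM]]|[M fM]].
  by exists (M + 1) => n; apply: (fM _ _ n I); rewrite ltrDl.
apply/mem_set; exists M; split; first exact: num_real.
by move=> x Mx n _; rewrite /= (le_trans (fM n)) // ltW.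
Qed.

Lemma bounded_seq_submod : submod_closed bounded_seq.
Proof.
split=> [|a f g /bounded_seqP[M fM] /bounded_seqP[N gN]]; apply/bounded_seqP.
  by exists 0 => n; rewrite normr0.
exists (`|a| * M + N) => n; apply: (le_trans (ler_normD _ _)).
by rewrite lerD // normrM ler_wpM2l.
Qed.

HB.instance Definition _ :=
  GRing.isSubmodClosed.Build R (nat -> R) bounded_seq bounded_seq_submod.

End Linfty.

Record linfty (R : realType) := Linfty {
  linfty_val :> nat -> R ;
  linfty_valP : linfty_val \in bounded_seq }.

HB.instance Definition _ (R : realType) := [isSub for @linfty_val R].
HB.instance Definition _ (R : realType) := [Choice of linfty R by <:].
HB.instance Definition _ (R : realType) :=
  [SubChoice_isSubLmodule of linfty R by <:].

Section LinftyNorm.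
Context {R : realType}.
Implicit Types f g : linfty R.

Definition linfty_norm f : R := sup [set `|f n| | n in [set: nat]].

Lemma linfty_norm_ub f n : `|f n| <= linfty_norm f.
Proof.
have [M fM] := (bounded_seqP f).1 (linfty_valP f).
apply: sup_upper_bound; last by exists n.
by split; [exists `|f 0%N|, 0%N | exists M => _ [k _ <-]].
Qed.

Lemma linfty_norm_le f (M : R) : (forall n, `|f n| <= M) -> linfty_norm f <= M.
Proof.
by move=> fM; apply: ge_sup; [exists `|f 0%N|, 0%N | move=> _ [k _ <-]].
Qed.

Lemma linfty_normD f g : linfty_norm (f + g) <= linfty_norm f + linfty_norm g.
Proof.
apply: linfty_norm_le => n; apply: (le_trans (ler_normD _ _)).
by rewrite lerD // linfty_norm_ub.
Qed.

Lemma linfty_norm_eq0 f : linfty_norm f = 0 -> f = 0.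
Proof.
move=> f0; apply/val_inj/funext => n; apply/normr0_eq0/eqP.
by rewrite eq_le normr_ge0 andbT -f0 linfty_norm_ub.
Qed.

Lemma linfty_normZ (a : R) f : linfty_norm (a *: f) = `|a| * linfty_norm f.
Proof.
have le b h : linfty_norm (b *: h) <= `|b| * linfty_norm h.
  apply: linfty_norm_le => n.
  by rewrite [X in `|X|](_ : _ = b * h n) // normrM ler_wpM2l // linfty_norm_ub.
have [->|a0] := eqVneq a 0.
  rewrite scale0r normr0 mul0r; apply/eqP; rewrite eq_le.
  rewrite (le_trans _ (linfty_norm_ub 0 0%N)) // andbT.
  by apply: linfty_norm_le => n; rewrite normr0.
apply/eqP; rewrite eq_le le /= -ler_pdivlMl ?normr_gt0 // -normfV.
by apply: le_trans (le _ _); rewrite scalerA mulVf // scale1r.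
Qed.

HB.instance Definition _ := Lmodule_isNormed.Build R (linfty R)
  linfty_normD linfty_normZ linfty_norm_eq0.

End LinftyNorm.

Record real_copy (R : realType) := RealCopy {
  rc_fun :> R -> linfty R ;
  rc_isometric : forall s t, `|rc_fun s - rc_fun t| = `|s - t| }.

Definition nneg_values (R : realType) (iota : real_copy R) : set (linfty R) :=
  iota @` [set t | 0 <= t].

(* A tuple of variables is represented by the tuple of sorts of its members;
   the variables themselves are the positions in it. *)
Record ctx (S : Type) := Ctx { ctx_len : nat ; ctx_sort : 'I_ctx_len -> S }.

Definition ctx_nil S : ctx S := @Ctx S 0 (fun i => False_rect S (notF (ltn_ord i))).

Definition ctx_cons S (s : S) (x : ctx S) : ctx S :=
  @Ctx S (ctx_len x).+1 (fun i => oapp (@ctx_sort S x) s (unlift ord0 i)).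

Definition ctx_cat S (x y : ctx S) : ctx S :=
  @Ctx S (ctx_len x + ctx_len y) (fun i =>
    match fintype.split i with inl j => ctx_sort j | inr k => ctx_sort k end).

Record language (R : realType) := Language {
  lsort : Type ;
  func : Type ;
  func_dom : func -> ctx lsort ;
  func_cod : func -> lsort ;
  func_modulus : func -> R -> R ;
  func_modulus_gt0 : forall f e, 0 < e -> 0 < func_modulus f e ;
  pred_symb : Type ;
  pred_dom : pred_symb -> ctx lsort ;
  pred_modulus : pred_symb -> R -> R ;
  pred_modulus_gt0 : forall P e, 0 < e -> 0 < pred_modulus P e ;
  pred_values : pred_symb -> set (linfty R) ;
  pred_values_compact : forall P, compact (pred_values P) }.

(* [Complete] includes a base point, i.e. nonemptiness. *)
#[short(type="completeMetricType")]
HB.structure Definition CompleteMetric (R : numDomainType) :=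
  { M of Metric R M & Complete M }.

Definition env S (A : S -> Type) (x : ctx S) := forall i, A (@ctx_sort S x i).

Record structure (R : realType) (L : language R) := Structure {
  carrier :> lsort L -> completeMetricType R ;
  carrier_diam : forall s (a b : carrier s), mdist a b <= 1 ;
  func_interp : forall f, env carrier (func_dom f) -> carrier (func_cod f) ;
  func_interp_uc : forall f (a b : env carrier (func_dom f)) (e : R), 0 < e ->
    (forall i, mdist (a i) (b i) < func_modulus f e) ->
    mdist (func_interp a) (func_interp b) <= e ;
  pred_interp : forall P, env carrier (pred_dom P) -> linfty R ;
  pred_interp_values : forall P (a : env carrier (pred_dom P)),
    pred_values P (pred_interp a) ;
  pred_interp_uc : forall P (a b : env carrier (pred_dom P)) (e : R), 0 < e ->
    (forall i, mdist (a i) (b i) < pred_modulus P e) ->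
    `|pred_interp a - pred_interp b| <= e }.

Section Points.
Context (R : realType) (L : language R) (M : structure L).

Definition points (x : ctx (lsort L)) := env (fun s => M s) x.

Definition points_nil : points (ctx_nil (lsort L)) :=
  fun i => False_rect _ (notF (ltn_ord i)).

Definition points_cons s x (m : M s) (a : points x) : points (ctx_cons s x) :=
  fun i => match unlift ord0 i as o return M (oapp (@ctx_sort _ x) s o) with
           | Some j => a j
           | None => m
           end.

Definition points_cat x y (a : points x) (b : points y) :
    points (ctx_cat x y) :=
  fun i => match fintype.split i as u return
             M match u with inl j => ctx_sort j | inr k => ctx_sort k end with
           | inl j => a j
           | inr k => b k
           end.

End Points.

Inductive term (R : realType) (L : language R) (x : ctx (lsort L)) :
    lsort L -> Type :=
| Var (i : 'I_(ctx_len x)) : term x (ctx_sort i)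
| App (f : func L) (ts : forall i, term x (@ctx_sort _ (func_dom f) i)) :
    term x (func_cod f).

(* [formula iota x K] is the type of formulas phi with free variables in x and
   with K_phi = K. The metric is a predicate symbol with value set [0, 1]. *)
Inductive formula (R : realType) (iota : real_copy R) (L : language R) :
    ctx (lsort L) -> set (linfty R) -> Type :=
| Pred x (P : pred_symb L) (ts : forall i, term x (@ctx_sort _ (pred_dom P) i)) :
    formula iota x (pred_values P)
| Dist x s (t1 t2 : @term R L x s) : formula iota x (iota @` `[0, 1])
| Conn x n (u : ('I_n -> linfty R) -> linfty R)
    (K : 'I_n -> set (linfty R)) :
    continuous (u : prod_topology (fun _ : 'I_n => linfty R) -> linfty R) ->
    (forall i, formula iota x (K i)) ->
    formula iota x (u @` [set v | forall i, K i (v i)])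
| Sup x s K : K `<=` nneg_values iota ->
    formula iota (ctx_cons s x) K -> formula iota x K
| Inf x s K : K `<=` nneg_values iota ->
    formula iota (ctx_cons s x) K -> formula iota x K.

Fixpoint term_eval (R : realType) (L : language R) (M : structure L)
    (x : ctx (lsort L)) s (t : term x s) (a : points M x) : M s :=
  match t in term _ s return M s with
  | Var i => a i
  | App f ts => func_interp (fun i => term_eval (ts i) a)
  end.

(* In the quantifier cases the values of psi lie in iota(R), so pulling them back
   along the injection iota loses nothing. *)
Fixpoint formula_eval (R : realType) (iota : real_copy R) (L : language R)
    (M : structure L) (x : ctx (lsort L)) K (phi : formula iota x K) :
    points M x -> linfty R :=
  match phi in formula _ x K return points M x -> linfty R with
  | Pred x P ts => fun a => pred_interp (fun i => term_eval (ts i) a)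
  | Dist x s t1 t2 => fun a => iota (mdist (term_eval t1 a) (term_eval t2 a))
  | Conn x n u K _ phis => fun a => u (fun i => formula_eval (phis i) a)
  | Sup x s K _ psi => fun a =>
      iota (sup [set r | exists m : M s,
                           iota r = formula_eval psi (points_cons m a)])
  | Inf x s K _ psi => fun a =>
      iota (inf [set r | exists m : M s,
                           iota r = formula_eval psi (points_cons m a)])
  end.

Record fml (R : realType) (iota : real_copy R) (L : language R)
    (x : ctx (lsort L)) := Fml {
  value_set : set (linfty R) ;
  fml_formula : formula iota x value_set }.

Arguments fml {R} iota {L} x.

Definition fml_eval (R : realType) (iota : real_copy R) (L : language R)
    (M : structure L) (x : ctx (lsort L)) (phi : fml iota x) (a : points M x) :
    linfty R :=
  formula_eval (fml_formula phi) a.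

Definition fml_conn (R : realType) (iota : real_copy R) (L : language R)
    (x : ctx (lsort L)) n (u : ('I_n -> linfty R) -> linfty R)
    (cu : continuous (u : prod_topology (fun _ : 'I_n => linfty R) -> linfty R))
    (phi : 'I_n -> fml iota x) : fml iota x :=
  Fml (Conn cu (fun i => fml_formula (phi i))).

Definition conn_add (R : realType) (v : 'I_2 -> linfty R) : linfty R :=
  v ord0 + v ord_max.

Definition conn_scale (R : realType) (r : R) (v : 'I_1 -> linfty R) : linfty R :=
  r *: v ord0.

Lemma conn_add_continuous (R : realType) :
  continuous (@conn_add R : prod_topology (fun _ : 'I_2 => linfty R) -> linfty R).
Proof.
move=> v.
have c i : (fun w : prod_topology (fun _ : 'I_2 => linfty R) => w i) @ v --> v i.
  exact: (@proj_continuous 'I_2 (fun _ => linfty R) i v).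
exact: (cvgD (c ord0) (c ord_max)).
Qed.

Lemma conn_scale_continuous (R : realType) (r : R) :
  continuous
    (@conn_scale R r : prod_topology (fun _ : 'I_1 => linfty R) -> linfty R).
Proof.
move=> v.
have c i : (fun w : prod_topology (fun _ : 'I_1 => linfty R) => w i) @ v --> v i.
  exact: (@proj_continuous 'I_1 (fun _ => linfty R) i v).
exact: (cvgZ (cvg_cst r) (c ord0)).
Qed.

Definition fml_add (R : realType) (iota : real_copy R) (L : language R)
    (x : ctx (lsort L)) (phi psi : fml iota x) : fml iota x :=
  fml_conn (@conn_add_continuous R) (fun i => if i == ord0 then phi else psi).

Definition fml_scale (R : realType) (iota : real_copy R) (L : language R)
    (x : ctx (lsort L)) (r : R) (phi : fml iota x) : fml iota x :=
  fml_conn (@conn_scale_continuous R r) (fun=> phi).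

Definition sentence (R : realType) (iota : real_copy R) (L : language R) :=
  fml iota (ctx_nil (lsort L)).

Definition sentence_eval (R : realType) (iota : real_copy R) (L : language R)
    (M : structure L) (sigma : sentence iota L) : linfty R :=
  fml_eval sigma (points_nil M).

(* A sentence sigma stands for the condition sigma = 0. *)
Definition theory (R : realType) (iota : real_copy R) (L : language R) :=
  set (sentence iota L).

Section Stability.
Context (R : realType) (iota : real_copy R) (L : language R)
  (T : theory iota L).

Definition models (M : structure L) : Prop :=
  forall sigma, T sigma -> sentence_eval M sigma = 0.

Definition complete_theory : Prop :=
  (exists M, models M) /\
  forall M N, models M -> models N ->
    forall sigma : sentence iota L, sentence_eval M sigma = sentence_eval N sigma.

Context (x y : ctx (lsort L)) (phi : fml iota (ctx_cat x y)).

Definition fml_eval2 (M : structure L) (a : points M x) (b : points M y) :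
    linfty R :=
  fml_eval phi (points_cat a b).

Definition constant_in : Prop :=
  forall M, models M -> forall (a a' : points M x) (b b' : points M y),
    fml_eval2 a b = fml_eval2 a' b'.

Definition diam : R :=
  sup [set e | exists M, models M /\
         exists (a a' : points M x) (b b' : points M y),
           e = `|fml_eval2 a b - fml_eval2 a' b'|].

Definition stable (e : R) : Prop :=
  ~ exists M : structure L, models M /\
    exists (r s : linfty R) (a : nat -> points M x) (b : nat -> points M y),
      [/\ value_set phi r, value_set phi s,
          forall i j, (i < j)%N ->
            fml_eval2 (a i) (b j) = r /\ fml_eval2 (a j) (b i) = s
        & e <= `|r - s| ].

Definition stb : R := inf [set e | 0 < e /\ stable e].

End Stability.

(* Main.v *)
Require Import Defs.
From HB Require Import structures.
From mathcomp Require Import all_boot all_order all_algebra.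
From mathcomp Require Import all_classical all_reals all_analysis.
From mathcomp Require Import generic_quotient lra.

(* The triangle inequality (3) is the only part with content. Given sequences
   a_i, b_j on which phi + psi is constantly r above the diagonal and s below
   it, compactness of the value set of phi and Ramsey's theorem give arbitrarily
   long finite subsequences on which phi is within 1/n of some p above and q
   below the diagonal. In a metric ultrapower of the model these
   approximations become equalities, so phi takes the values p and q, and psi
   the values r - p and s - q; since |r - s| <= |p - q| + |(r - p) - (s - q)|,
   one of phi and psi must witness its own share of the instability. That the
   ultrapower is a model of T is Los's theorem. *)

Import Order.TTheory GRing.Theory Num.Theory.
Import numFieldNormedType.Exports.

Set Implicit Arguments.
Unset Strict Implicit.
Unset Printing Implicit Defensive.

Local Open Scope classical_set_scope.
Local Open Scope ring_scope.

(** * Metric ultrapowers along an ultrafilter on nat *)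

Lemma ultra_fmap (I T : Type) (F : set_system I) (f : I -> T) :
  UltraFilter F -> UltraFilter (f @ F).
Proof.
move=> UF; split=> [|G PG FG]; first exact: fmap_proper_filter.
apply/seteqP; split=> [A GA|]; last exact: FG.
case: (in_ultra_setVsetC (f @^-1` A) UF) => // FnA.
have GnA : G (~` A) by exact: FG.
by have [x []] := filter_ex (filterI GA GnA).
Qed.

Lemma compact_ultra_cvg (I : Type) (T : topologicalType) (F : set_system I)
    (K : set T) (f : I -> T) :
  UltraFilter F -> compact K -> (forall i, K (f i)) ->
  exists2 l, K l & f i @[i --> F] --> l.
Proof.
move=> UF; rewrite compact_ultra => /(_ (f @ F) (ultra_fmap f UF)) cK Kf.
by have [|l [Kl fl]] := cK; [apply: nearW|exists l].
Qed.

(** A nonprincipal ultrafilter, obtained by extending the filter of cofinite sets. *)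
Definition nat_ultra : set_system nat :=
  projT1 (cid (ultraFilterLemma eventually_filter)).

#[global] Instance nat_ultra_ultra : UltraFilter nat_ultra.
Proof. by rewrite /nat_ultra; case: cid => ? []. Qed.

#[global] Instance nat_ultra_proper : ProperFilter nat_ultra.
Proof. exact: ultra_proper. Qed.

Lemma nat_ultra_ge k : \forall n \near nat_ultra, (k <= n)%N.
Proof.
suff: \oo `<=` nat_ultra by apply; exact: nbhs_infty_ge.
by rewrite /nat_ultra; case: cid => ? [].
Qed.

(** Countable saturation by diagonalisation: [z n] is chosen for the largest [k <= n] such that the
    conditions [P 0 n], ..., [P k n] are jointly satisfiable. The bound by [n] makes this maximum
    exist, and a fixed [k] lies below it for almost all [n]. *)
Lemma nat_ultra_saturated (T : Type) (P : nat -> nat -> T -> Prop) :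
  inhabited T ->
  (forall k, \forall n \near nat_ultra,
    exists t, forall j, (j <= k)%N -> P j n t) ->
  exists z : nat -> T, forall k, \forall n \near nat_ultra, P k n (z n).
Proof.
move=> [t0] Pex.
pose Q n k := (k <= n)%N /\ exists t, forall j, (j <= k)%N -> P j n t.
have /choice[z zP] n : exists t, forall k, Q n k -> P k n t.
  have [[k0 Qk0]|nQ] := pselect (exists k, Q n k); last first.
    by exists t0 => k Qk; case: nQ; exists k.
  have ex : exists k, `[< Q n k >] by exists k0; apply/asboolP.
  have ub k : `[< Q n k >] -> (k <= n)%N by move=> /asboolP[].
  case: (ex_maxnP ex ub) => k /asboolP[_ [t tP]] kmax.
  by exists t => j /asboolP /kmax; exact: tP.
exists z => k; near=> n; apply: zP; split; near: n.
  exact: nat_ultra_ge.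
exact: Pex.
Unshelve. all: by end_near. Qed.

Lemma filter_ramsey (T : pointedType) (F : set_system T) (P : T -> T -> Prop) n :
  ProperFilter F ->
  (\forall i \near F, \forall j \near F, P i j) ->
  exists f : nat -> T, forall i j, (i < j < n)%N -> P (f i) (f j).
Proof.
move=> PF FP.
(* Invariant of the induction: each chosen point is related to [F]-almost every point, so finitely
   many such requirements on the next point still define a set of [F]. *)
suff [f [_ fP]] : exists f : nat -> T,
    (forall i, (i < n)%N -> \forall j \near F, P (f i) j) /\
    forall i j, (i < j < n)%N -> P (f i) (f j).
  by exists f.
elim: n => [|n [f [fF fP]]].
  by exists (fun=> point); split=> // i j; rewrite ltn0 andbF.
have Fall : \forall j \near F, forall i : 'I_n, P (f i) j.
  apply: filter_forall => i; exact: fF.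
have [t [Ft Pt]] := filter_ex (filterI FP Fall).
exists (fun i => if (i < n)%N then f i else t); split=> [i|i j].
  by rewrite ltnS leq_eqVlt => /predU1P[->|ltin]; rewrite ?ltnn// ltin; exact: fF.
rewrite ltnS => /andP[ltij lejn]; rewrite (leq_trans ltij lejn).
have [ltjn|_] := ltnP j n; first by apply: fP; rewrite ltij.
exact: (Pt (Ordinal (leq_trans ltij lejn))).
Qed.

(** * Ultralimits of distances *)

Section UltraDistance.
Context (R : realType) (M : metricType R).
Context (dM : forall a b : M, mdist a b <= 1).
Implicit Types u v w : nat -> M.

Definition ultra_dist u v : R := lim (mdist (u n) (v n) @[n --> nat_ultra]).

(** The limit exists because all distances lie in the compact interval [0, 1]. *)
Lemma cvg_ultra_dist u v :
  mdist (u n) (v n) @[n --> nat_ultra] --> ultra_dist u v.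
Proof.
have [|l _ ul] := @compact_ultra_cvg _ _ nat_ultra _
  (fun n => mdist (u n) (v n)) _ (@segment_compact R 0 1).
  by move=> n; rewrite /= in_itv /= mdist_ge0 dM.
by rewrite /ultra_dist; have /cvg_lim -> := ul.
Qed.

Lemma ultra_distE u v l :
  mdist (u n) (v n) @[n --> nat_ultra] --> l -> ultra_dist u v = l.
Proof. exact: cvg_lim. Qed.

Lemma ultra_distxx u : ultra_dist u u = 0.
Proof.
by apply: ultra_distE; under eq_fun do rewrite mdistxx; exact: cvg_cst.
Qed.

Lemma ultra_dist_sym u v : ultra_dist u v = ultra_dist v u.
Proof.
by apply: ultra_distE; under eq_fun do rewrite metric_sym; exact: cvg_ultra_dist.
Qed.

Lemma ultra_dist_triangle v u w :
  ultra_dist u w <= ultra_dist u v + ultra_dist v w.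
Proof.
have uvw : mdist (u n) (v n) + mdist (v n) (w n) @[n --> nat_ultra] -->
    ultra_dist u v + ultra_dist v w.
  by apply: cvgD; exact: cvg_ultra_dist.
apply: (ler_cvg_to (@cvg_ultra_dist u w) uvw).
by apply: nearW => n; exact: metric_triangle.
Qed.

Lemma ultra_dist_ge0 u v : 0 <= ultra_dist u v.
Proof.
by apply: (limr_ge (cvgP _ (@cvg_ultra_dist u v))); apply: nearW => n;
  exact: mdist_ge0.
Qed.

Lemma ultra_dist_le u v e :
  (\forall n \near nat_ultra, mdist (u n) (v n) <= e) -> ultra_dist u v <= e.
Proof. exact: (limr_le (cvgP _ (@cvg_ultra_dist u v))). Qed.

Lemma ultra_dist_lt u v e :
  ultra_dist u v < e -> \forall n \near nat_ultra, mdist (u n) (v n) < e.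
Proof. exact: (cvgr_lt _ (@cvg_ultra_dist u v)). Qed.

(** Coarser than agreement on a set of the ultrafilter: sequences at infinitesimal distance are
    identified too, so that the quotient is a metric space. *)
Definition ultra_eq u v := `[< ultra_dist u v = 0 >].

Lemma ultra_eq_equiv : equiv_class_of ultra_eq.
Proof.
split=> [u|u v|v u w].
- by apply/asboolP; exact: ultra_distxx.
- by rewrite /ultra_eq ultra_dist_sym.
- move=> /asboolP uv /asboolP vw; apply/asboolP/eqP.
  rewrite eq_le ultra_dist_ge0 andbT (le_trans (ultra_dist_triangle v _ _)) //.
  by rewrite uv vw addr0.
Qed.

Canonical ultra_equiv := EquivRelPack ultra_eq_equiv.

End UltraDistance.

Definition ultrapower (R : realType) (M : completeMetricType R)
    (dM : forall a b : M, mdist a b <= 1) : Type :=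
  {eq_quot ultra_equiv dM}%qT.

(** * The metric ultrapower and its completeness *)

Section Ultrapower.
Context (R : realType) (M : completeMetricType R).
Context (dM : forall a b : M, mdist a b <= 1).

HB.instance Definition _ := Choice.on (ultrapower dM).

Definition ultra_class (u : nat -> M) : ultrapower dM :=
  \pi_({eq_quot ultra_equiv dM})%qT u.

Definition ultra_repr (a : ultrapower dM) : nat -> M :=
  @repr _ {eq_quot ultra_equiv dM}%qT a.

Lemma ultra_reprK a : ultra_class (ultra_repr a) = a.
Proof. exact: reprK. Qed.

Lemma ultra_classP u v : ultra_class u = ultra_class v <-> ultra_dist u v = 0.
Proof.
by split=> [/eqquotP/asboolP|uv] //; apply/eqquotP/asboolP.
Qed.

Let dist a b := ultra_dist (ultra_repr a) (ultra_repr b).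

Let distxx a : dist a a = 0. Proof. exact: ultra_distxx. Qed.

Let dist_positivity a b : dist a b = 0 -> a = b.
Proof. by move=> /ultra_classP; rewrite !ultra_reprK. Qed.

Let dist_sym a b : dist a b = dist b a. Proof. exact: ultra_dist_sym. Qed.

Let dist_triangle b a c : dist a c <= dist a b + dist b c.
Proof. exact: ultra_dist_triangle. Qed.

HB.instance Definition _ := isMetric.Build R (ultrapower dM)
  distxx dist_positivity dist_sym dist_triangle.

HB.instance Definition _ := isPointed.Build (ultrapower dM)
  (ultra_class (fun=> point)).

(** The metric is defined through chosen representatives; the triangle inequality makes it
    independent of that choice. *)
Lemma mdist_ultra_class u v :
  mdist (ultra_class u) (ultra_class v) = ultra_dist u v.
Proof.
have zero w : ultra_dist (ultra_repr (ultra_class w)) w = 0.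
  by apply/ultra_classP; rewrite ultra_reprK.
apply/eqP; rewrite eq_le; apply/andP; split.
  rewrite (le_trans (ultra_dist_triangle dM u _ _)) // zero add0r.
  rewrite (le_trans (ultra_dist_triangle dM v _ _)) //.
  by rewrite [X in _ + X]ultra_dist_sym// zero addr0.
rewrite (le_trans (ultra_dist_triangle dM (ultra_repr (ultra_class u)) _ _)) //.
rewrite (ultra_dist_sym dM u) zero add0r.
rewrite (le_trans (ultra_dist_triangle dM (ultra_repr (ultra_class v)) _ _)) //.
by rewrite zero addr0.
Qed.

Lemma ultrapower_diam (a b : ultrapower dM) : mdist a b <= 1.
Proof.
rewrite -(ultra_reprK a) -(ultra_reprK b) mdist_ultra_class.
by apply: ultra_dist_le => //; apply: nearW => n; exact: dM.
Qed.

(** Completeness comes from saturation: the limit is the class of a sequence [z] that is close to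
    every [u k], a countable family of conditions. *)
Lemma ultrapower_cauchy_cvg (F : set_system (ultrapower dM)) :
  ProperFilter F -> cauchy F -> cvg F.
Proof.
move=> PF /cauchyP cF.
pose e k : R := 2^-1 ^+ k.
have e0 k : 0 < e k by rewrite exprn_gt0 // invr_gt0.
have /choice[x xP] k : exists a : ultrapower dM, F (ball a (e k)) by exact: cF.
pose u k := ultra_repr (x k).
(* The balls around [x j] and [x k] are both in [F], hence meet; their radii are at most [e j]. *)
have d_lt j k : (j <= k)%N -> ultra_dist (u j) (u k) < e j *+ 2.
  move=> jk; rewrite -mdist_ultra_class !ultra_reprK.
  have [z []] := filter_ex (filterI (xP j) (xP k)).
  rewrite !ballEmdist /= => jz kz.
  rewrite (le_lt_trans (metric_triangle _ z _)) // mulr2n ltrD //.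
  rewrite metric_sym (lt_le_trans kz) // /e.
  by apply: ler_wiXn2l => //; rewrite ?invr_ge0 // invf_le1 // ler1n.
have [||z zP] := @nat_ultra_saturated M (fun k n t => mdist (u k n) t < e k *+ 2).
- by split; exact: point.
(* The conditions up to [k] are met together by [u k] itself, at almost every coordinate. *)
- move=> k.
  have : \forall n \near nat_ultra,
      forall j : 'I_k.+1, mdist (u j n) (u k n) < e j *+ 2.
    apply: filter_forall => j; apply: ultra_dist_lt => //.
    by apply: d_lt; rewrite -ltnS.
  by apply: filterS => n nP; exists (u k n) => j jk; exact: (nP (@Ordinal k.+1 j jk)).
apply/cvg_ex; exists (ultra_class z); apply/metricType_numDomainType.fcvgrPdist_lt => d d0.
(* One [e k] for the distance from a point of the ball to [x k], two for the distance from [x k] to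
   the class of [z]. *)
have [k ek] : exists k, e k *+ 3 < d.
  have : 3 * e k @[k --> \oo] --> (3 * 0 : R).
    apply: cvgMr; apply: cvg_expr.
    by rewrite ger0_norm ?invr_ge0 // invf_lt1 // ltr1n.
  rewrite mulr0 => /(cvgr_lt 0) /(_ d d0) [k _ /(_ k (leqnn _))] ek.
  by exists k; rewrite -mulr_natl.
apply: filterS (xP k) => a; rewrite ballEmdist /= => xa.
rewrite (le_lt_trans (metric_triangle _ (x k) _)) //.
apply: le_lt_trans ek; rewrite mulrSr lerD ?(ltW xa) // metric_sym -(ultra_reprK (x k)).
rewrite mdist_ultra_class; apply: ultra_dist_le => //.
by apply: filterS (zP k) => n; exact: ltW.
Qed.

HB.instance Definition _ := Uniform_isComplete.Build (ultrapower dM)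
  ultrapower_cauchy_cvg.

End Ultrapower.

(** * Suprema and value sets *)

(** From below, a near-optimal point of the ultrapower is followed along its representative. From
    above, near-optimal points of the coordinates are assembled into one sequence [u], whose class
    bounds the limit. *)
Lemma cvg_ultra_sup (R : realType) (M : completeMetricType R)
    (dM : forall a b : M, mdist a b <= 1) (h : nat -> M -> R)
    (g : ultrapower dM -> R) (B : R) :
  (forall n m, h n m <= B) ->
  (forall u : nat -> M,
    h n (u n) @[n --> nat_ultra] --> g (ultra_class dM u)) ->
  sup (range (h n)) @[n --> nat_ultra] --> sup (range g).
Proof.
move=> hB hg.
have gB m : g m <= B.
  rewrite -(ultra_reprK m); apply: (cvgr_to_le (hg (ultra_repr m))).
  by apply: nearW => n; exact: hB.
have hsup n : has_sup (range (h n)).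
  by split; [exists (h n point), point|exists B => _ [m _ <-]].
have gsup : has_sup (range g).
  by split; [exists (g point), point|exists B => _ [m _ <-]].
apply/cvgrPdist_lt => e e0; near=> n; rewrite ltr_distlC; apply/andP; split.
- near: n.
  have [_ [m _ <-]] := sup_adherent e0 gsup; rewrite -(ultra_reprK m).
  move=> /(cvgr_gt _ (hg (ultra_repr m))); apply: filterS => n /lt_le_trans; apply.
  by apply: ub_le_sup; [case: (hsup n)|exists (ultra_repr m n)].
- near: n.
  have e20 : 0 < e / 2 by rewrite divr_gt0.
  have /choice[u uP] n : exists m, sup (range (h n)) - e / 2 < h n m.
    by have [_ [m _ <-] mP] := sup_adherent e20 (hsup n); exists m.
  have : g (ultra_class dM u) < sup (range g) + e / 2.
    apply: (@le_lt_trans _ _ (sup (range g))); last by rewrite ltrDl.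
    by apply: ub_le_sup; [case: gsup|exists (ultra_class dM u)].
  move=> /(cvgr_lt _ (hg u)); apply: filterS => n; have := uP n; lra.
Unshelve. all: by end_near. Qed.

Lemma cvg_ultra_inf (R : realType) (M : completeMetricType R)
    (dM : forall a b : M, mdist a b <= 1) (h : nat -> M -> R)
    (g : ultrapower dM -> R) (B : R) :
  (forall n m, B <= h n m) ->
  (forall u : nat -> M,
    h n (u n) @[n --> nat_ultra] --> g (ultra_class dM u)) ->
  inf (range (h n)) @[n --> nat_ultra] --> inf (range g).
Proof.
move=> hB hg; rewrite /inf; apply: cvgN; rewrite image_comp.
under eq_fun do rewrite image_comp.
apply: (@cvg_ultra_sup _ _ _ _ _ (- B)) => [n m|u] /=; first by rewrite lerN2.
exact: cvgN.
Qed.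

(** * The copy of the reals and the value sets of formulas *)

Section Values.
Context (R : realType) (iota : real_copy R).

Lemma rc_inj : injective iota.
Proof.
move=> s t st; apply/eqP; rewrite -subr_eq0 -normr_eq0.
by rewrite -(rc_isometric iota) st subrr normr0.
Qed.

Lemma rc_cvgP (I : Type) (F : set_system I) (FF : Filter F) (f : I -> R) (l : R) :
  iota (f i) @[i --> F] --> iota l <-> f i @[i --> F] --> l.
Proof.
split=> /cvgrPdist_lt fl; apply/cvgrPdist_lt => e /fl; apply: filterS => i;
  by rewrite (rc_isometric iota).
Qed.

Lemma rc_continuous : continuous iota.
Proof. by move=> t; apply/rc_cvgP; exact: cvg_id. Qed.

Definition rc_inv (v : linfty R) : R := xget 0 [set t | iota t = v].

Lemma rc_invK v : nneg_values iota v -> iota (rc_inv v) = v.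
Proof. by move=> [t _ tv]; rewrite /rc_inv; case: xgetP => // /(_ t). Qed.

Lemma rc_inv_ge0 v : nneg_values iota v -> 0 <= rc_inv v.
Proof.
move=> vn; have [t t0 tv] := vn.
by rewrite -(rc_inj (etrans (rc_invK vn) (esym tv))) in t0.
Qed.

Lemma rc_inv_bounded (K : set (linfty R)) : compact K ->
  K `<=` nneg_values iota -> exists B, forall v, K v -> rc_inv v <= B.
Proof.
move=> /compact_bounded [B [_ /(_ (B + 1))]]; rewrite ltrDl ltr01 => /(_ isT) KB Kn.
(* [iota] is only isometric and may move 0, hence the term [|iota 0|]. *)
exists (B + 1 + `|iota 0|) => v Kv.
rewrite (le_trans (ler_norm _)) // -[X in `|X|]subr0 -(rc_isometric iota).
rewrite (le_trans (ler_normB _ _)) // lerD2r rc_invK; last exact: Kn.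
exact: KB.
Qed.

(** Brings the set in the semantics of a quantifier into the form of a range, as [cvg_ultra_sup] and
    [cvg_ultra_inf] require. *)
Lemma rc_inv_range (T : Type) (f : T -> linfty R) :
  (forall m, nneg_values iota (f m)) ->
  [set r | exists m, iota r = f m] = range (rc_inv \o f).
Proof.
move=> fn; apply/seteqP; split=> [r [m rm]|_ [m _ <-]].
  by exists m => //=; apply: rc_inj; rewrite rc_invK.
by exists m; rewrite /= rc_invK.
Qed.

(** The supremum is in the closure of [E], and the preimage of [K] is closed; hence a quantifier
    keeps the value set of its formula. *)
Lemma rc_sup_mem (K : set (linfty R)) (E : set R) : compact K ->
  E !=set0 -> has_ubound E -> (forall t, E t -> K (iota t)) -> K (iota (sup E)).
Proof.
move=> /(compact_closed (@norm_hausdorff _ _)) cK E0 Eub EK.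
have : closed (iota @^-1` K).
  by apply: closed_comp => // t _; exact: rc_continuous.
by apply; apply: closure_subset EK _ _; exact: closure_sup.
Qed.

Lemma rc_inf_mem (K : set (linfty R)) (E : set R) : compact K ->
  E !=set0 -> has_lbound E -> (forall t, E t -> K (iota t)) -> K (iota (inf E)).
Proof.
move=> /(compact_closed (@norm_hausdorff _ _)) cK [t Et] Elb EK; rewrite /inf.
(* [inf E] unfolds to minus the supremum of the negated set, so closedness is transported along
   [iota \o -%R]. *)
have iotaN : continuous (iota \o -%R).
  move=> s; apply: continuous_comp; last exact: rc_continuous.
  exact: opp_continuous.
have : closed ((iota \o -%R) @^-1` K).
  by apply: closed_comp => // s _; exact: iotaN.
apply; apply: (@closure_subset _ (-%R @` E)).
  by move=> _ [s Es <-] /=; rewrite opprK; exact: EK.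
apply: closure_sup; first by exists (- t), t.
exact/has_lb_ubN.
Qed.

Context (L : language R).

Lemma value_set_compact x K (phi : @formula R iota L x K) : compact K.
Proof.
elim: phi => {x K} [x P ts|x s t1 t2|x n u K cu phis IH
  |x s K Kn psi IH|x s K Kn psi IH] //.
- exact: pred_values_compact.
- apply: continuous_compact; last exact: segment_compact.
  exact: continuous_subspaceT rc_continuous.
- apply: (@continuous_compact (prod_topology (fun _ : 'I_n => linfty R))).
    exact: continuous_subspaceT.
  exact: tychonoff.
Qed.

Lemma formula_eval_values (M : structure L) x K (phi : formula iota x K)
    (a : points M x) :
  K (formula_eval phi a).
Proof.
elim: phi a => {x K} [x P ts|x s t1 t2|x n u K cu phis IH
  |x s K Kn psi IH|x s K Kn psi IH] a /=.
- exact: pred_interp_values.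
- exists (mdist (term_eval t1 a) (term_eval t2 a)) => //.
  by rewrite /= in_itv /= mdist_ge0 carrier_diam.
- by exists (fun i => formula_eval (phis i) a) => // i; exact: IH.
- have [B KB] := rc_inv_bounded (value_set_compact psi) Kn.
  rewrite rc_inv_range; last by move=> m; exact/Kn/IH.
  apply: rc_sup_mem; first exact: value_set_compact psi.
  + by exists (rc_inv (formula_eval psi (points_cons point a))), point.
  + by exists B => _ [m _ <-]; exact: KB.
  + by move=> _ [m _ <-] /=; rewrite rc_invK //; exact: Kn.
- rewrite rc_inv_range; last by move=> m; exact/Kn/IH.
  apply: rc_inf_mem; first exact: value_set_compact psi.
  + by exists (rc_inv (formula_eval psi (points_cons point a))), point.
  + by exists 0 => _ [m _ <-]; apply: rc_inv_ge0; exact: Kn.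
  + by move=> _ [m _ <-] /=; rewrite rc_invK //; exact: Kn.
Qed.

End Values.

(** * Los's theorem *)

Lemma cvg_prod_topology (I : eqType) (T : I -> topologicalType) (J : Type)
    (F : set_system J) (FF : Filter F) (f : J -> prod_topology T)
    (l : prod_topology T) :
  (forall i, f j i @[j --> F] --> l i) -> f @ F --> l.
Proof.
move=> fl; apply/cvg_sup.
move=> i U [V [[W oW <-] Wl] WU].
have lW : nbhs (l i) W by exact: open_nbhs_nbhs.
by move: (fl i W lW); apply: (@filterS _ F) => j; exact: WU.
Qed.

Section UltrapowerStructure.
Context (R : realType) (L : language R) (M : structure L).

Let UM (s : lsort L) : completeMetricType R := ultrapower (@carrier_diam R L M s).

Let reprs (x : ctx (lsort L)) (a : env UM x) n : points M x :=
  fun i => ultra_repr (a i) n.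

(** Stated for arbitrary sequences rather than chosen representatives, so that it yields both the
    modulus in the ultrapower and the independence of representatives. Finiteness of the arity lets
    one set of the ultrafilter serve all arguments. *)
Lemma func_interp_ultra_uc f (u v : nat -> points M (func_dom f)) e : 0 < e ->
  (forall i, ultra_dist (u^~ i) (v^~ i) < func_modulus f e) ->
  ultra_dist (fun n => func_interp (u n)) (fun n => func_interp (v n)) <= e.
Proof.
move=> e0 uv; apply: ultra_dist_le => //; first exact: carrier_diam.
have : \forall n \near nat_ultra,
    forall i, mdist (u n i) (v n i) < func_modulus f e.
  apply: filter_forall => i; apply: (ultra_dist_lt (@carrier_diam _ _ _ _) (uv i)).
by apply: filterS => n; exact: func_interp_uc.
Qed.

Lemma cvg_pred_interp_ultra P (u : nat -> points M (pred_dom P)) :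
  pred_interp (u n) @[n --> nat_ultra] -->
  (lim (pred_interp (u n) @[n --> nat_ultra]) : linfty R).
Proof.
have [|l _ ul] := @compact_ultra_cvg _ _ nat_ultra _ (fun n => pred_interp (u n))
  _ (@pred_values_compact R L P).
  by move=> n; exact: pred_interp_values.
by have /(cvg_lim (@norm_hausdorff _ _)) -> := ul.
Qed.

Lemma pred_interp_ultra_uc P (u v : nat -> points M (pred_dom P))
    (lu lv : linfty R) e :
  0 < e -> pred_interp (u n) @[n --> nat_ultra] --> lu ->
  pred_interp (v n) @[n --> nat_ultra] --> lv ->
  (forall i, ultra_dist (u^~ i) (v^~ i) < pred_modulus P e) ->
  `|lu - lv| <= e.
Proof.
move=> e0 ul vl uv.
have dl : `|pred_interp (u n) - pred_interp (v n)| @[n --> nat_ultra] -->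
    `|lu - lv|.
  by apply: cvg_norm; exact: cvgB.
apply: (cvgr_to_le dl).
have : \forall n \near nat_ultra,
    forall i, mdist (u n i) (v n i) < pred_modulus P e.
  apply: filter_forall => i; apply: (ultra_dist_lt (@carrier_diam _ _ _ _) (uv i)).
by apply: filterS => n; exact: pred_interp_uc.
Qed.

Let ultra_func f (a : env UM (func_dom f)) : UM (func_cod f) :=
  ultra_class _ (fun n => func_interp (reprs a n)).

Let ultra_pred P (a : env UM (pred_dom P)) : linfty R :=
  lim (pred_interp (reprs a n) @[n --> nat_ultra]).

Let ultra_func_uc f (a b : env UM (func_dom f)) (e : R) : 0 < e ->
  (forall i, mdist (a i) (b i) < func_modulus f e) ->
  mdist (ultra_func a) (ultra_func b) <= e.
Proof.
move=> e0 ab; rewrite mdist_ultra_class; exact: func_interp_ultra_uc.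
Qed.

Let ultra_pred_values P (a : env UM (pred_dom P)) :
  pred_values P (ultra_pred a).
Proof.
have cP : closed (pred_values P).
  exact: compact_closed (@norm_hausdorff _ _) (@pred_values_compact _ _ _).
have aP : \forall n \near nat_ultra, pred_values P (pred_interp (reprs a n)).
  by apply: nearW => n; exact: pred_interp_values.
exact: (closed_cvg _ cP aP _ (@cvg_pred_interp_ultra P (reprs a))).
Qed.

Let ultra_pred_uc P (a b : env UM (pred_dom P)) (e : R) : 0 < e ->
  (forall i, mdist (a i) (b i) < pred_modulus P e) ->
  `|ultra_pred a - ultra_pred b| <= e.
Proof.
move=> e0 ab; apply: pred_interp_ultra_uc (e0) (@cvg_pred_interp_ultra P (reprs a))
  (@cvg_pred_interp_ultra P (reprs b)) _ => i.
exact: (ab i).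
Qed.

Definition ultra_structure : structure L :=
  @Structure R L UM (fun s => @ultrapower_diam R (M s) _)
    ultra_func ultra_func_uc ultra_pred ultra_pred_values ultra_pred_uc.

Definition ultra_point x (a : nat -> points M x) : points ultra_structure x :=
  fun i => ultra_class _ (a^~ i).

Lemma term_eval_ultra x s (t : term x s) (a : nat -> points M x) :
  term_eval t (ultra_point a) = ultra_class _ (fun n => term_eval t (a n)).
Proof.
elim: t => [//|f ts IH] /=; apply/ultra_classP/eqP.
rewrite eq_le ultra_dist_ge0 ?andbT; last exact: carrier_diam.
(* Arguments at ultralimit distance 0 are within every modulus, so the values are within every
   [e]. *)
apply/ler_addgt0Pl => e e0; rewrite addr0; apply: func_interp_ultra_uc => // i.
rewrite (_ : ultra_dist _ _ = 0) ?func_modulus_gt0 //.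
by apply/(ultra_classP (@carrier_diam R L M _)); exact: etrans (ultra_reprK _) (IH i).
Qed.

Lemma pred_interp_ultra P (u : nat -> points M (pred_dom P)) :
  pred_interp (u n) @[n --> nat_ultra] -->
  (@pred_interp _ _ ultra_structure P (ultra_point u) : linfty R).
Proof.
suff -> : @pred_interp _ _ ultra_structure P (ultra_point u) =
    lim (pred_interp (u n) @[n --> nat_ultra]) by exact: cvg_pred_interp_ultra.
apply/eqP; rewrite -subr_eq0 -normr_eq0 eq_le normr_ge0 andbT.
apply/ler_addgt0Pl => e e0; rewrite addr0.
apply: pred_interp_ultra_uc (e0) (@cvg_pred_interp_ultra P _)
  (@cvg_pred_interp_ultra P _) _ => i.
rewrite (_ : ultra_dist _ _ = 0) ?pred_modulus_gt0 //.
by apply/(ultra_classP (@carrier_diam R L M _)); exact: ultra_reprK.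
Qed.

Lemma ultra_point_cons s x (m : nat -> M s) (a : nat -> points M x) :
  points_cons (ultra_class (@carrier_diam R L M s) m : ultra_structure s)
    (ultra_point a) =
  ultra_point (fun n => points_cons (m n) (a n)).
Proof.
apply: functional_extensionality_dep => i; rewrite /points_cons /ultra_point /ctx_cons /=.
by case: (unlift ord0 i).
Qed.

Lemma ultra_point_cat x y (a : nat -> points M x) (b : nat -> points M y) :
  points_cat (ultra_point a) (ultra_point b) =
  ultra_point (fun n => points_cat (a n) (b n)).
Proof.
apply: functional_extensionality_dep => i; rewrite /points_cat /ultra_point /ctx_cat /=.
by case: (fintype.split i).
Qed.

Context (iota : real_copy R).

(* [a] is an arbitrary sequence of representatives, so that near-optimal
   witnesses can be chosen coordinatewise in the quantifier steps: no uniform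
   continuity of formulas is needed. *)
Lemma formula_eval_ultra x K (phi : formula iota x K) (a : nat -> points M x) :
  formula_eval phi (a n) @[n --> nat_ultra] -->
  formula_eval phi (ultra_point a).
Proof.
elim: phi a => {x K} [x P ts|x s t1 t2|x n u K cu phis IH
  |x s K Kn psi IH|x s K Kn psi IH] a /=.
- rewrite (_ : (fun i => _) = ultra_point (fun n i => term_eval (ts i) (a n))).
    exact: pred_interp_ultra.
  by apply: functional_extensionality_dep => i; rewrite term_eval_ultra.
- apply/rc_cvgP; rewrite !term_eval_ultra mdist_ultra_class.
  by apply: cvg_ultra_dist; exact: carrier_diam.
- pose v i := formula_eval (phis i) (ultra_point a).
  apply: (@continuous_cvg _ (prod_topology (fun _ : 'I_n => linfty R)) _ _ _
    (fun k i => formula_eval (phis i) (a k)) u v); first exact: cu.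
  by apply: cvg_prod_topology => i; exact: IH.
- have [B KB] := rc_inv_bounded (value_set_compact psi) Kn.
  have Keval N (c : points N x) m :=
    Kn _ (formula_eval_values psi (@points_cons _ _ N s x m c)).
  under eq_fun do rewrite rc_inv_range//.
  rewrite rc_inv_range//; apply/rc_cvgP.
  apply: (@cvg_ultra_sup _ _ (@carrier_diam R L M s)
    (fun n m => rc_inv iota (formula_eval psi (points_cons m (a n)))) _ B) => [n m|m] /=.
    by apply: KB; exact: formula_eval_values.
  apply/(rc_cvgP iota); under eq_fun do rewrite rc_invK//.
  by rewrite rc_invK// ultra_point_cons; exact: IH.
- have Keval N (c : points N x) m :=
    Kn _ (formula_eval_values psi (@points_cons _ _ N s x m c)).
  under eq_fun do rewrite rc_inv_range//.
  rewrite rc_inv_range//; apply/rc_cvgP.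
  apply: (@cvg_ultra_inf _ _ (@carrier_diam R L M s)
    (fun n m => rc_inv iota (formula_eval psi (points_cons m (a n)))) _ 0) => [n m|m] /=.
    exact: rc_inv_ge0.
  apply/(rc_cvgP iota); under eq_fun do rewrite rc_invK//.
  by rewrite rc_invK// ultra_point_cons; exact: IH.
Qed.

End UltrapowerStructure.

(** * Stability *)

Section Stability.
Context (R : realType) (iota : real_copy R) (L : language R).
Context (x y : ctx (lsort L)).
Implicit Types (T : theory iota L) (phi psi : fml iota (ctx_cat x y)).

(** Los's theorem along a constant sequence: the value of an axiom in the ultrapower is the limit of
    the constant 0. *)
Lemma models_ultra T (M : structure L) : models T M -> models T (ultra_structure M).
Proof.
move=> TM sigma Tsigma; rewrite /sentence_eval /fml_eval.
have -> : points_nil (ultra_structure M) = ultra_point (fun=> points_nil M).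
  by apply: functional_extensionality_dep => -[].
have := @formula_eval_ultra _ _ M _ _ _ (fml_formula sigma) (fun=> points_nil M).
under eq_fun do rewrite [formula_eval _ _](TM sigma Tsigma).
move=> /(cvg_lim (@norm_hausdorff _ _)) <-.
by rewrite lim_cst//; exact: norm_hausdorff.
Qed.

Lemma fml_eval2_ultra (M : structure L) phi (a : nat -> points M x)
    (b : nat -> points M y) (l : linfty R) :
  fml_eval2 phi (a n) (b n) @[n --> nat_ultra] --> l ->
  fml_eval2 phi (ultra_point a) (ultra_point b) = l.
Proof.
move=> abl; rewrite /fml_eval2 ultra_point_cat; apply/esym.
exact: (cvg_unique (@norm_hausdorff _ _) abl (@formula_eval_ultra _ _ M _ _ _ _ _)).
Qed.

Lemma fml_eval2_values (M : structure L) phi (a : points M x) (b : points M y) :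
  value_set phi (fml_eval2 phi a b).
Proof. exact: formula_eval_values. Qed.

(* [f n] extracts a subsequence whose first [n] terms are within 1/(n+1) of p
   and q; only these finitely many terms are controlled. *)
Lemma ultra_subsequence (M : structure L) phi (a : nat -> points M x)
    (b : nat -> points M y) :
  exists (f : nat -> nat -> nat) (p q : linfty R),
    (forall n i j, (i < j < n)%N -> (f n i < f n j)%N) /\
    forall i j, (i < j)%N ->
      fml_eval2 phi (ultra_point (fun n => a (f n i)))
                    (ultra_point (fun n => b (f n j))) = p /\
      fml_eval2 phi (ultra_point (fun n => a (f n j)))
                    (ultra_point (fun n => b (f n i))) = q.
Proof.
have cK : compact (value_set phi) by exact: value_set_compact (fml_formula phi).
(* Iterated ultralimit, first in [j] for fixed [i] and then in [i]; compactness of the value set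
   gives both. *)
have lim2 (g : nat -> nat -> linfty R) : (forall i j, value_set phi (g i j)) ->
    exists l, forall e, 0 < e ->
      \forall i \near nat_ultra, \forall j \near nat_ultra, `|l - g i j| < e.
  move=> gK.
  have /choice[h hP] i : exists l,
      value_set phi l /\ g i j @[j --> nat_ultra] --> l.
    by have [l] := compact_ultra_cvg nat_ultra_ultra cK (gK i); exists l.
  have [l _ hl] := compact_ultra_cvg nat_ultra_ultra cK (fun i => (hP i).1).
  exists l => e e0; have e20 : 0 < e / 2 by rewrite divr_gt0.
  move/cvgrPdist_lt : hl => /(_ _ e20); apply: filterS => i lhi.
  have /cvgrPdist_lt /(_ _ e20) := (hP i).2; apply: filterS => j hg.
  rewrite (splitr e) -(subrKA (h i)).
  by rewrite (le_lt_trans (ler_normD _ _)) // ltrD.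
have [|p pP] := lim2 (fun i j => fml_eval2 phi (a i) (b j)).
  by move=> *; exact: fml_eval2_values.
(* The arguments are swapped so that the inner limit again runs over the larger index. *)
have [|q qP] := lim2 (fun i j => fml_eval2 phi (a j) (b i)).
  by move=> *; exact: fml_eval2_values.
have /choice[f fP] n : exists f : nat -> nat, forall i j, (i < j < n)%N ->
    [/\ (f i < f j)%N, `|p - fml_eval2 phi (a (f i)) (b (f j))| < n.+1%:R^-1
      & `|q - fml_eval2 phi (a (f j)) (b (f i))| < n.+1%:R^-1].
  apply: (@filter_ramsey _ nat_ultra (fun i j =>
    [/\ (i < j)%N, `|p - fml_eval2 phi (a i) (b j)| < n.+1%:R^-1
      & `|q - fml_eval2 phi (a j) (b i)| < n.+1%:R^-1])).
  have n0 : 0 < n.+1%:R^-1 :> R by rewrite invr_gt0.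
  apply: filterS2 (pP _ n0) (qP _ n0) => i ip iq.
  by apply: filterS3 (nat_ultra_ge i.+1) ip iq => j.
exists f, p, q; split=> [n i j /fP[]//|i j ij].
(* For almost all [n] the pair [i < j] is among the controlled terms and the tolerance is below
   [e]. *)
have inv_lt (e : R) : 0 < e ->
    \forall n \near nat_ultra, (j < n)%N /\ n.+1%:R^-1 < e.
  move=> e0; near=> n; split; first by near: n; exact: nat_ultra_ge.
  rewrite invf_plt ?posrE // (lt_le_trans (truncnS_gt _)) // ler_nat.
  by near: n; apply: filterS (nat_ultra_ge (Num.truncn e^-1)) => n; rewrite ltnS.
split; apply: fml_eval2_ultra; apply/cvgrPdist_lt => e /inv_lt;
  apply: filterS => n [jn ne].
- by have [|_ + _] := fP n i j; [rewrite ij|move=> /lt_trans; exact].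
- by have [|_ _ +] := fP n i j; [rewrite ij|move=> /lt_trans; exact].
Unshelve. all: by end_near. Qed.

Lemma stable_add T phi psi e1 e2 :
  stable T phi e1 -> stable T psi e2 -> stable T (fml_add phi psi) (e1 + e2).
Proof.
move=> st1 st2 [M [TM [r [s [a [b [_ _ ab ers]]]]]]].
have [f [p [q [fmono pq]]]] := ultra_subsequence phi a b.
pose A i := ultra_point (fun n => a (f n i)).
pose B i := ultra_point (fun n => b (f n i)).
have addE N (c : points N x) (d : points N y) :
  fml_eval2 (fml_add phi psi) c d = fml_eval2 phi c d + fml_eval2 psi c d by [].
have rs i j : (i < j)%N ->
    fml_eval2 psi (A i) (B j) = r - p /\ fml_eval2 psi (A j) (B i) = s - q.
  move=> ij; have [<- <-] := pq i j ij.
  (* Where the order is preserved the sum equals [r] or [s] exactly, so the values of [psi] follow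
     by subtraction. *)
  have evf : \forall n \near nat_ultra, (f n i < f n j)%N.
    by apply: filterS (nat_ultra_ge j.+1) => n jn; apply: fmono; rewrite ij.
  have rlim : fml_eval2 (fml_add phi psi) (A i) (B j) = r.
    apply: fml_eval2_ultra; apply: cvg_near_cst.
    by apply: filterS evf => n /ab[].
  have slim : fml_eval2 (fml_add phi psi) (A j) (B i) = s.
    apply: fml_eval2_ultra; apply: cvg_near_cst.
    by apply: filterS evf => n /ab[].
  by rewrite -rlim -slim !addE !(addrC (fml_eval2 phi _ _)) !addrK.
have TU := models_ultra TM.
have pqe1 : `|p - q| < e1.
  (* Both are attained in the ultrapower, hence lie in the value set. *)
  have [Kp Kq] : value_set phi p /\ value_set phi q.
    by have [<- <-] := pq 0 1 isT; split; exact: fml_eval2_values.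
  rewrite ltNge; apply/negP => e1pq; apply: st1; exists (ultra_structure M).
  by split=> //; exists p, q, A, B.
have rse2 : `|(r - p) - (s - q)| < e2.
  have [Kr Ks] : value_set psi (r - p) /\ value_set psi (s - q).
    by have [<- <-] := rs 0 1 isT; split; exact: fml_eval2_values.
  rewrite ltNge; apply/negP => e2rs; apply: st2; exists (ultra_structure M).
  by split=> //; exists (r - p), (s - q), A, B.
have : `|r - s| < e1 + e2.
  rewrite (_ : r - s = (p - q) + ((r - p) - (s - q))).
    by rewrite (le_lt_trans (ler_normD _ _)) // ltrD.
  by rewrite opprB addrCA !subrKA.
by rewrite ltNge ers.
Qed.

Lemma stable_constant T phi e : constant_in T phi -> 0 < e -> stable T phi e.
Proof.
move=> Cphi e0 [M [TM [r [s [a [b [_ _ ab]]]]]]]; apply/negP; rewrite -ltNge.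
have [<- <-] := ab 0 1 isT.
by rewrite (Cphi M TM (a 0) (a 1) (b 1) (b 0)) subrr normr0.
Qed.

(** Scaling the two values by [r], and back by [r^-1], matches the instability witnesses of [phi]
    with those of its multiple. *)
Lemma stable_scale T phi (r e : R) : r != 0 ->
  stable T (fml_scale r phi) (`|r| * e) <-> stable T phi e.
Proof.
move=> r0; have scaleE N (c : points N x) (d : points N y) :
  fml_eval2 (fml_scale r phi) c d = r *: fml_eval2 phi c d by [].
have normE (p q : linfty R) : `|r *: p - r *: q| = `|r| * `|p - q|.
  by rewrite -scalerBr normrZ.
split=> st [M [TM [p [q [a [b [Kp Kq ab epq]]]]]]]; apply: st;
  exists M; split=> //.
- exists (r *: p), (r *: q), a, b; split.
  + by exists (fun=> p).
  + by exists (fun=> q).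
  + by move=> i j /ab[]; rewrite !scaleE => -> ->.
  + by rewrite normE ler_pM2l ?normr_gt0.
- have pE i j : (i < j)%N -> fml_eval2 phi (a i) (b j) = r^-1 *: p /\
      fml_eval2 phi (a j) (b i) = r^-1 *: q.
    by move=> /ab[]; rewrite !scaleE => <- <-; rewrite !scalerK.
  exists (r^-1 *: p), (r^-1 *: q), a, b; split=> //.
  + by have [<- _] := pE 0 1 isT; exact: fml_eval2_values.
  + by have [_ <-] := pE 0 1 isT; exact: fml_eval2_values.
  + by rewrite -(ler_pM2l (x := `|r|)) ?normr_gt0 // -normE !scalerA divff //
      !scale1r.
Qed.

(** The supremum in [diam] runs over all models, but the value set is the same in each, so its
    compactness gives a uniform bound. *)
Lemma diam_ub T phi (M : structure L) (a a' : points M x) (b b' : points M y) :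
  models T M -> `|fml_eval2 phi a b - fml_eval2 phi a' b'| <= diam T phi.
Proof.
move=> TM; apply: ub_le_sup; last by exists M; split=> //; exists a, a', b, b'.
have /compact_bounded[B [_ /(_ (B + 1))]] := value_set_compact (fml_formula phi).
rewrite ltrDl ltr01 => /(_ isT) KB.
exists (B + 1 + (B + 1)) => _ [N [_ [c [c' [d [d' ->]]]]]].
by rewrite (le_trans (ler_normB _ _)) // lerD // KB //; exact: fml_eval2_values.
Qed.

Lemma stable_gt_diam T phi e : diam T phi < e -> stable T phi e.
Proof.
move=> de [M [TM [r [s [a [b [_ _ ab]]]]]]]; apply/negP; rewrite -ltNge.
have [<- <-] := ab 0 1 isT; exact: le_lt_trans (diam_ub _ _ _ _ _ TM) de.
Qed.

(** Rules out the default value of [inf]: any positive threshold above the diameter is stable. The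
    absolute value in the witness makes its positivity immediate. *)
Lemma stb_has_inf T phi : has_inf [set e | 0 < e /\ stable T phi e].
Proof.
split; last by exists 0 => e [/ltW].
exists (`|diam T phi| + 1); split; first by rewrite ltr_pwDr.
by apply: stable_gt_diam; rewrite ltr_pwDr // ler_norm.
Qed.

Lemma stb_ge0 T phi : 0 <= stb T phi.
Proof. by apply: lb_le_inf; [case: (stb_has_inf T phi)|move=> e [/ltW]]. Qed.

Lemma stb_le T phi e : 0 < e -> stable T phi e -> stb T phi <= e.
Proof. by move=> e0 st; apply: ge_inf => //; case: (stb_has_inf T phi). Qed.

Lemma stb_adherent T phi e : 0 < e ->
  exists d, [/\ 0 < d, stable T phi d & d < stb T phi + e].
Proof.
by move=> e0; have [d [d0 st] de] := inf_adherent e0 (stb_has_inf T phi); exists d.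
Qed.

Lemma stb_constant T phi : constant_in T phi -> stb T phi = 0.
Proof.
move=> Cphi; apply/eqP; rewrite eq_le stb_ge0 andbT.
apply/ler_addgt0Pl => e e0; rewrite addr0.
by apply: stb_le => //; exact: stable_constant.
Qed.

Lemma stb_scale T phi r : stb T (fml_scale r phi) = `|r| * stb T phi.
Proof.
(* Thresholds cannot be rescaled back when [r = 0], but then the multiple is constant. *)
have [->|r0] := eqVneq r 0.
  rewrite normr0 mul0r; apply: stb_constant => M _ a a' b b'.
  transitivity (0 *: fml_eval2 phi a b); first by [].
  by rewrite scale0r -(scale0r (fml_eval2 phi a' b')).
have nr0 : 0 < `|r| by rewrite normr_gt0.
apply/eqP; rewrite eq_le; apply/andP; split.
- rewrite -ler_pdivrMl //; apply: lb_le_inf; first by case: (stb_has_inf T phi).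
  move=> e [e0 st]; rewrite ler_pdivrMl //.
  by apply: stb_le; rewrite ?mulr_gt0 //; exact/stable_scale.
- apply: lb_le_inf; first by case: (stb_has_inf T (fml_scale r phi)).
  move=> e [e0 st]; rewrite -ler_pdivlMl //; apply: stb_le.
    by rewrite mulr_gt0 // invr_gt0.
  by apply/(stable_scale _ _ _ r0); rewrite mulVKf ?gt_eqF.
Qed.

Lemma stb_add T phi psi : stb T (fml_add phi psi) <= stb T phi + stb T psi.
Proof.
apply/ler_addgt0Pr => e e0; have e20 : 0 < e / 2 by rewrite divr_gt0.
have [d1 [d10 st1 d1e]] := stb_adherent T phi e20.
have [d2 [d20 st2 d2e]] := stb_adherent T psi e20.
rewrite (le_trans (stb_le (addr_gt0 d10 d20) (stable_add st1 st2))) //.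
by rewrite ltW // (splitr e) addrACA ltrD.
Qed.

Lemma stb_le_diam T phi (M : structure L) : models T M -> stb T phi <= diam T phi.
Proof.
move=> TM.
(* Makes [diam T phi + e] a positive threshold; the base points of the sorts of [M] supply a
   difference to compare with. *)
have d0 : 0 <= diam T phi.
  by rewrite (le_trans _ (@diam_ub T phi M (fun=> point) (fun=> point)
    (fun=> point) (fun=> point) TM)).
apply/ler_addgt0Pr => e e0; apply: stb_le; first by rewrite ltr_wpDl.
by apply: stable_gt_diam; rewrite ltrDl.
Qed.

End Stability.

Theorem lemma5p3 (R : realType) (iota : real_copy R) (L : language R)
    (T : theory iota L) (T_complete : complete_theory T)
    (x y : ctx (lsort L)) (phi psi : fml iota (ctx_cat x y)) (r : R) :
  [/\ constant_in T phi -> stb T phi = 0,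
      stb T (fml_scale r phi) = `|r| * stb T phi,
      stb T (fml_add phi psi) <= stb T phi + stb T psi
    & stb T phi <= diam T phi].
Proof.
have [[M TM] _] := T_complete; split.
- exact: stb_constant.
- exact: stb_scale.
- exact: stb_add.
- exact: stb_le_diam TM.
Qed.
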